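(* Let $G$ be a locally compact abelian group such that $G/G^\circ$ is topologically finitely generated, and let $\Gamma$ be a countable residually finite group. Suppose that $\phi:G\longrightarrow\Gamma$ is an abstract surjective group homomorphism. Then $\phi$ is continuous and open, where $\Gamma$ carries the discrete topology.
   Context: All topological groups are assumed to be Hausdorff. $G^\circ$ denotes the identity component of $G$. A topological group is topologically finitely generated if it has a finitely generated dense subgroup. A set $S$ is countable if $\#S\leq\aleph_0$; every countable group is viewed as a discrete locally compact group. A group is residually finite if the intersection of all its normal subgroups of finite index is trivial. A homomorphism between topological groups is called abstract if no continuity assumption is made on it. *)

(* Defs.v *)
From HB Require Import structures.
From mathcomp Require Import all_boot all_order all_algebra.
From mathcomp Require Import generic_quotient ring_quotient.
From mathcomp Require Import all_classical topology.
From mathcomp Require Import tvs.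

Set Implicit Arguments.
Unset Strict Implicit.
Unset Printing Implicit Defensive.

Import GRing.Theory.
Local Open Scope classical_set_scope.
Local Open Scope ring_scope.
Local Open Scope quotient_scope.

(* Locally compact abelian groups are written additively; a zmodClosed boolean
   predicate is what the quotient construction of ring_quotient expects. *)
Definition id_comp (G : topologicalZmodType) : {pred G} :=
  [in connected_component [set: G] 0].

Section IdentityComponent.
Variable G : topologicalZmodType.

Lemma id_comp_zmod_closed : zmod_closed (@id_comp G).
Proof.
split; first by rewrite inE; exact: connected_component_refl.
move=> u v; rewrite !inE => Cu Cv.
pose C := connected_component [set: G] 0.
have cf : continuous (fun x : G => x - v).
  move=> x; apply: (@continuous_comp _ _ _ (fun x : G => (x, v))
    (fun z : G * G => z.1 - z.2)); last exact: sub_continuous.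
  by apply: cvg_pair; [exact: cvg_id | exact: cvg_cst].
have conn : connected ((fun x : G => x - v) @` C).
  apply: connected_continuous_connected; first exact: component_connected.
  exact: continuous_subspaceT.
apply: (connected_component_max (B := (fun x : G => x - v) @` C)) => //.
- by exists v => //; rewrite subrr.
- by exists u.
Qed.

HB.instance Definition _ :=
  GRing.isZmodClosed.Build G (@id_comp G) id_comp_zmod_closed.

End IdentityComponent.

Definition quot_group (G : topologicalZmodType) (H : zmodClosed G) : Type :=
  quotient_topology (Quotient.quot H).

Section QuotientGroup.
Variables (G : topologicalZmodType) (H : zmodClosed G).
Local Notation Q := (quot_group H).

HB.instance Definition _ := Topological.on Q.
(* Rebuilt from the operations of Quotient.quot rather than copied: a copy would
   bring a choice structure different from the one of quotient_topology. *)
HB.instance Definition _ := GRing.isZmodule.Build Q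
  (@Quotient.addqA G H) (@Quotient.addqC G H)
  (@Quotient.add0q G H) (@Quotient.addNq G H).

Lemma quot_group_pi_open (U : set G) : open U -> open (\pi_Q @` U : set Q).
Proof.
move=> oU; rewrite /open/= /quotient_open.
have -> : \pi_Q @^-1` (\pi_Q @` U) =
    \bigcup_(h in [set h | h \in H]) ((fun x : G => x - h) @^-1` U).
  apply/seteqP; split=> [x [u Uu /= /eqP]|x [h /= hH Uxh]].
    rewrite eq_sym -Quotient.idealrBE => xuH.
    by exists (x - u) => //=; rewrite opprB addrCA subrr addr0.
  exists (x - h) => //; apply/eqP.
  by rewrite -Quotient.idealrBE addrAC subrr sub0r rpredN.
apply: bigcup_open => h _; apply: open_comp => // x _.
apply: (@continuous_comp _ _ _ (fun x : G => (x, h))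
    (fun z : G * G => z.1 - z.2)); last exact: sub_continuous.
by apply: cvg_pair; [exact: cvg_id | exact: cvg_cst].
Qed.

Lemma quot_group_pi_nbhs (x : G) (U : set G) :
  nbhs x U -> nbhs (\pi_Q x : Q) (\pi_Q @` U).
Proof.
rewrite nbhsE => -[V [oV Vx] VU].
apply: (@filterS _ (nbhs (\pi_Q x : Q)) _ (\pi_Q @` V)).
  exact: image_subset.
apply: open_nbhs_nbhs; split; first exact: quot_group_pi_open.
by exists x.
Qed.

Lemma quot_group_piB (x y : G) : \pi_Q (x - y) = (\pi_Q x : Q) - \pi_Q y.
Proof.
exact: (@pi_is_zmod_morphism _ _ _ (Quotient.quot H)).
Qed.

Lemma quot_group_sub_continuous : continuous (fun x : Q * Q => x.1 - x.2).
Proof.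
move=> [p q]; rewrite -[p]reprK -[q]reprK.
set x := repr p; set y := repr q => A /=.
rewrite -quot_group_piB => nA.
have /sub_continuous [[U V] /= [nU nV] UV]
    : nbhs ((x, y).1 - (x, y).2) (\pi_Q @^-1` A).
  exact: (@pi_continuous _ (Quotient.quot H)).
exists (\pi_Q @` U, \pi_Q @` V) => /=; first by split; exact: quot_group_pi_nbhs.
move=> [_ _] [/= [u Uu <-] [v Vv <-]].
by rewrite -quot_group_piB; exact: (UV (u, v)).
Qed.

HB.instance Definition _ :=
  PreTopologicalNmodule_isTopologicalZmodule.Build Q quot_group_sub_continuous.

End QuotientGroup.

Definition topologically_finitely_generated (A : topologicalZmodType) : Prop :=
  exists s : seq A,
    dense (smallest [set K : set A | zmod_closed [in K]] [set` s]).

Local Open Scope group_scope.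

Definition normal_subgroup (Gamma : groupType) (N : set Gamma) : Prop :=
  group_closed [in N] /\ forall g x, N x -> N (x ^ g).

Definition finite_index (Gamma : groupType) (N : set Gamma) : Prop :=
  finite_set (range (fun g : Gamma => [set g * n | n in N])).

Definition residually_finite (Gamma : groupType) : Prop :=
  \bigcap_(N in [set N : set Gamma | normal_subgroup N /\ finite_index N]) N
  = [set 1].

Definition open_map (T U : topologicalType) (f : T -> U) : Prop :=
  forall A : set T, open A -> open (f @` A).

(* Main.v *)
Require Import Defs.
From mathcomp Require Import all_boot all_order all_algebra all_field.
From mathcomp Require Import generic_quotient ring_quotient zify.
From mathcomp Require Import all_classical topology tvs.

(* The kernel of [phi] is the intersection of the preimages of the finite-index
   normal subgroups, and each of these contains some [nG].  So it suffices that
   every [nG] is open: the kernel is then closed and of countable index, hence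
   open by Baire.

   A maximal subgroup [M] meeting a compact neighbourhood of [0] only in [0] is
   discrete and satisfies [G = M + B] with [B] compact (this is Weil's dichotomy
   for monothetic groups, relative to [M]); as [nG = nM + nB], [nG] is closed.
   The identity component is contained in [nG] because compact groups of finite
   exponent are totally disconnected.  The latter follows from Bogolyubov's
   theorem on finite groups, used on maps [(Z/n)^m -> G/nG]: if finitely many
   translates of [V + nG] cover [G], then every sum of small elements is, modulo
   [V + V - V - V + nG], the sum of a number of them bounded in terms of [V]
   alone.  Finally [G/nG] has a dense finitely generated subgroup, which is
   finite because of the exponent [n]; so [nG] is closed of finite index. *)

Set Implicit Arguments.
Unset Strict Implicit.
Unset Printing Implicit Defensive.

Import Order.TTheory GRing.Theory Num.Theory.

Local Open Scope classical_set_scope.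
Local Open Scope ring_scope.

(** * Bogolyubov's theorem for groups of finite exponent *)

Section FiniteFourier.
Variables n m : nat.
Local Notation Zn := 'Z_n.+2.
Local Notation Z := 'rV[Zn]_m.
Implicit Types (a b x y : Z) (E : {set Z}).

Definition dot a x : Zn := \sum_i a 0 i * x 0 i.

Lemma dotDl a b x : dot (a + b) x = dot a x + dot b x.
Proof.
by rewrite /dot -big_split; apply: eq_bigr => i _; rewrite mxE mulrDl.
Qed.

Lemma dotC a x : dot a x = dot x a.
Proof. by apply: eq_bigr => i _; rewrite mulrC. Qed.

Lemma dotDr a x y : dot a (x + y) = dot a x + dot a y.
Proof. by rewrite !(dotC a) dotDl. Qed.

Lemma dot0r a : dot a 0 = 0.
Proof. by apply: (addrI (dot a 0)); rewrite -dotDr !addr0. Qed.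

Lemma dotNr a x : dot a (- x) = - dot a x.
Proof. by apply/(addrI (dot a x)); rewrite -dotDr !subrr dot0r. Qed.

Lemma dot_delta i x : dot (delta_mx 0 i) x = x 0 i.
Proof.
rewrite /dot (bigD1 i) //= mxE !eqxx mul1r big1 ?addr0 // => j ji.
by rewrite mxE (negPf ji) andbF mul0r.
Qed.

Variable w : algC.
Hypothesis wP : n.+2.-primitive_root w.

(** These are all the characters of the finite group [Z], which [dot] makes self-dual; taking a
    representative of [dot a x] is harmless as [w] has order [n.+2]. The modulus is written [n.+2]
    because ['Z_p] is the ring of integers mod [p] only for [p] at least 2. *)
Definition chi a x : algC := w ^+ (dot a x : nat).

Lemma chiDr a x y : chi a (x + y) = chi a x * chi a y.
Proof. by rewrite /chi dotDr -exprD /= (prim_expr_mod wP). Qed.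

Lemma chiDl a b x : chi (a + b) x = chi a x * chi b x.
Proof. by rewrite /chi dotDl -exprD /= (prim_expr_mod wP). Qed.

Lemma chi0r a : chi a 0 = 1.
Proof. by rewrite /chi dot0r. Qed.

Lemma chi0l x : chi 0 x = 1.
Proof. by rewrite /chi dotC dot0r. Qed.

Lemma norm_chi a x : `|chi a x| = 1.
Proof.
rewrite /chi normrX; suff -> : `|w| = 1 by rewrite expr1n.
apply/eqP; rewrite -(@pexpr_eq1 _ _ n.+2) // -normrX (prim_expr_order wP).
by rewrite normr1.
Qed.

Lemma chiN a x : chi a (- x) = (chi a x)^*.
Proof.
have chi_neq0 : chi a x != 0 by rewrite -normr_eq0 norm_chi oner_eq0.
apply: (mulfI chi_neq0); rewrite -chiDr subrr chi0r -normCK norm_chi.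
by rewrite expr1n.
Qed.

(** If [x] is nonzero, some coordinate character [chi b] is not 1 at [x]; translating the summation
    index by [b] multiplies the sum by [chi b x], so the sum vanishes. *)
Lemma chi_orthogonality x :
  \sum_a chi a x = if x == 0 then #|{: Z}|%:R else 0.
Proof.
case: eqP => [->|/eqP xn0].
  under eq_bigr do rewrite chi0r.
  by rewrite sumr_const.
have [i xi0] : exists i, x 0 i != 0.
  apply/existsP; apply: contraR xn0; rewrite negb_exists => /forallP x0.
  by apply/eqP/rowP => i; rewrite mxE; apply/eqP; rewrite -[_ == _]negbK.
pose b : Z := delta_mx 0 i.
have chib : chi b x != 1.
  rewrite /chi dot_delta -(prim_order_dvd wP).
  apply: contra xi0 => /dvdnP[[|q] xq]; first by apply/eqP/val_inj.
  have := ltn_ord (x 0 i); rewrite [X in (X < _)%N]xq mulSn.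
  by rewrite ltnNge leq_addr.
apply/eqP; have : (chi b x - 1) * \sum_a chi a x == 0.
  rewrite mulrBl mul1r subr_eq0; apply/eqP.
  rewrite [RHS](reindex_inj (addrI b)) mulr_sumr.
  by apply: eq_bigr => a _; rewrite chiDl.
by rewrite mulf_eq0 subr_eq0 (negPf chib).
Qed.

Variable E : {set Z}.
Local Notation hat a := (\sum_(x in E) chi a x).
Local Notation N := #|{: Z}|.

Lemma hat_norm2 a : `|hat a| ^+ 2 = \sum_(x in E) \sum_(y in E) chi a (x - y).
Proof.
rewrite normCK rmorph_sum mulr_suml; apply: eq_bigr => x _.
by rewrite mulr_sumr; apply: eq_bigr => y _; rewrite chiDr chiN.
Qed.

Lemma parseval : \sum_a `|hat a| ^+ 2 = (N * #|E|)%:R.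
Proof.
under eq_bigr do rewrite hat_norm2.
rewrite exchange_big natrM mulr_natr -sumr_const; apply: eq_bigr => x xE.
rewrite exchange_big (bigD1 x) //= chi_orthogonality subrr eqxx big1 ?addr0 //.
by move=> y /andP[_ yx]; rewrite chi_orthogonality subr_eq0 eq_sym (negPf yx).
Qed.

(** Expand the fourth power and sum over [a] first: by orthogonality only quadruples with
    [x1 - x2 + (x3 - x4) = y] survive. *)
Lemma hat_norm4 y :
  (forall x1 x2 x3 x4, x1 \in E -> x2 \in E -> x3 \in E -> x4 \in E ->
     y != x1 - x2 + (x3 - x4)) ->
  \sum_a `|hat a| ^+ 2 ^+ 2 * chi a (- y) = 0.
Proof.
move=> yE; have -> : \sum_a `|hat a| ^+ 2 ^+ 2 * chi a (- y) =
    \sum_a \sum_(x1 in E) \sum_(x2 in E) \sum_(x3 in E) \sum_(x4 in E)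
      chi a (x1 - x2 + (x3 - x4) - y).
  apply: eq_bigr => a _; rewrite expr2 {1}hat_norm2 hat_norm2 -mulrA mulr_suml.
  apply: eq_bigr => x1 _; rewrite mulr_suml; apply: eq_bigr => x2 _.
  rewrite mulrCA mulr_suml; apply: eq_bigr => x3 _.
  rewrite mulr_suml; apply: eq_bigr => x4 _.
  by rewrite mulrCA mulrA !chiDr !mulrA.
rewrite exchange_big big1 // => x1 x1E.
rewrite exchange_big big1 // => x2 x2E.
rewrite exchange_big big1 // => x3 x3E.
rewrite exchange_big big1 // => x4 x4E.
by rewrite chi_orthogonality subr_eq0 eq_sym (negPf (yE _ _ _ _ _ _ _ _)).
Qed.

(* Frequencies [a] with [`|hat a| ^ 2 < #|E|^3 / N] contribute too little to
   [sum_a `|hat a|^4 chi a (- y)], which vanishes for [y] outside E - E + E - E,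
   to cancel the contribution of the others if these are trivial on [y]. *)
Lemma bogolyubov_chi k : (N <= k * #|E|)%N ->
  exists2 L : {set Z}, (#|L| <= k ^ 2)%N &
    forall y, (forall a, a \in L -> dot a y = 0) ->
      exists x1 x2 x3 x4, [/\ x1 \in E, x2 \in E, x3 \in E, x4 \in E &
        y = x1 - x2 + (x3 - x4)].
Proof.
move=> NkE; pose h a := `|hat a| ^+ 2.
have h_ge0 a : 0 <= h a by rewrite exprn_ge0.
have E_gt0 : (0 < #|E|)%N.
  rewrite lt0n; apply: contraTneq NkE => ->; rewrite muln0 -ltnNge.
  by apply/card_gt0P; exists 0.
have E_gt0C : 0 < #|E|%:R :> algC by rewrite ltr0n.
have N_gt0 : 0 < N%:R :> algC.
  by rewrite ltr0n; apply/card_gt0P; exists 0.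
pose L : {set Z} := [set a | #|E|%:R ^+ 3 <= N%:R * h a]%SET.
exists L.
  (* By Parseval the large frequencies number at most [(N / #|E|)^2], which is at most [k^2]. *)
  have : #|L|%:R * #|E|%:R ^+ 3 <= N%:R * (N * #|E|)%:R :> algC.
    rewrite -parseval mulr_natl -sumr_const mulr_sumr.
    rewrite [leRHS](bigID (mem L)) /= -[leLHS]addr0 lerD //.
      by apply: ler_sum => a; rewrite inE.
    by apply: sumr_ge0 => a _; rewrite mulr_ge0 ?h_ge0 ?ler0n.
  rewrite -natrX -!natrM ler_nat mulnA expnSr mulnA leq_pmul2r // => LN.
  rewrite -(leq_pmul2r (_ : 0 < #|E| ^ 2)%N) ?expn_gt0 ?E_gt0 //.
  by apply: (leq_trans LN); rewrite -expnMn -mulnn leq_mul.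
move=> y yL; apply: contrapT => yNE.
have /hat_norm4 : forall x1 x2 x3 x4, x1 \in E -> x2 \in E -> x3 \in E ->
    x4 \in E -> y != x1 - x2 + (x3 - x4).
  move=> x1 x2 x3 x4 *; apply/eqP => yE; apply: yNE.
  by exists x1, x2, x3, x4.
rewrite (bigID (mem L)) /=; under eq_bigr => a aL do
  rewrite /chi dotNr yL // oppr0 expr0 mulr1.
move=> /eqP; rewrite addr_eq0 => /eqP sumL.
have L0 : 0 \in L.
  rewrite inE /h; under eq_bigr do rewrite chi0l.
  rewrite sumr_const normr_nat exprS ler_wpM2r ?exprn_ge0 ?ler0n //.
  by rewrite ler_nat max_card.
(* The sum over [L] is at least its term at 0 and is cancelled by the sum over the complement, where
   one factor [h a] is below the threshold. *)
have : N%:R * h 0 ^+ 2 <= #|E|%:R ^+ 3 * \sum_(a | a \notin L) h a.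
  apply: (@le_trans _ _ (N%:R * \sum_(a in L) h a ^+ 2)).
    rewrite ler_wpM2l ?ler0n // (bigD1 0) //= lerDl.
    by apply: sumr_ge0 => a _; rewrite exprn_ge0.
  rewrite -[\sum_(a in L) _]ger0_norm; last first.
    by apply: sumr_ge0 => a _; rewrite exprn_ge0.
  rewrite sumL normrN.
  apply: (@le_trans _ _ (N%:R * \sum_(a | a \notin L) h a ^+ 2)).
    rewrite ler_wpM2l ?ler0n //; apply: (le_trans (ler_norm_sum _ _ _)).
    by apply: ler_sum => a _; rewrite normrM norm_chi mulr1 ger0_norm
      ?exprn_ge0.
  rewrite !mulr_sumr; apply: ler_sum => a; rewrite inE => aL.
  rewrite expr2 mulrA ler_wpM2r //; apply: ltW.
  rewrite real_ltNge //; apply: ger0_real.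
    by rewrite mulr_ge0 ?ler0n ?h_ge0.
  by rewrite exprn_ge0 ?ler0n.
have h0 : h 0 = #|E|%:R ^+ 2.
  rewrite /h; under eq_bigr do rewrite chi0l.
  by rewrite sumr_const normr_nat.
(* Strict because the positive term [h 0] of Parseval's sum is missing on the left; both estimates
   together give [N * #|E|^4 < N * #|E|^4]. *)
have : \sum_(a | a \notin L) h a < N%:R * #|E|%:R.
  rewrite -natrM -parseval [ltRHS](bigID (mem L)) /= ltrDr (bigD1 0) //=.
  apply: ltr_wpDr; first by apply: sumr_ge0 => a _; exact: h_ge0.
  by rewrite -/(h 0) h0 exprn_gt0.
rewrite h0 => lt1 le1; have := le_lt_trans le1.
rewrite -(ltr_pM2l (_ : 0 < #|E|%:R ^+ 3)) ?exprn_gt0 // in lt1.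
by move=> /(_ _ lt1); rewrite -exprM [ltRHS]mulrCA -exprSr ltxx.
Qed.

End FiniteFourier.

(** Pigeonhole: in a list longer than [#|Q|] two prefixes have the same sum, and the segment between
    them can be cut out. *)
Lemma short_subsum (Q : finZmodType) (T : eqType) (f : T -> Q) (s : seq T) :
  exists t, [/\ subseq t s, (size t <= #|Q|)%N &
    \sum_(x <- t) f x = \sum_(x <- s) f x].
Proof.
have [k] := ubnP (size s); elim: k s => // k IHk s ks.
have [sQ|Qs] := leqP (size s) #|Q|; first by exists s.
pose g (i : 'I_(size s).+1) := \sum_(x <- take i s) f x.
have /injectivePn [i [j ij gij]] : ~~ injectiveb g.
  apply/injectiveP => /leq_card; rewrite card_ord => sQ.
  have := leq_trans (ltnW Qs) (ltnW sQ).
  by rewrite leqNgt (leq_trans Qs) // ltnW.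
wlog lij : i j ij gij / (i < j)%N.
  move=> wl; have [lij|lji|/val_inj eij] := ltngtP i j.
  - exact: (wl i j).
  - by apply: (wl j i) => //; rewrite eq_sym.
  - by rewrite eij eqxx in ij.
have js : (j <= size s)%N by rewrite -ltnS ltn_ord.
have := IHk (take i s ++ drop j s); case.
  rewrite size_cat size_takel ?size_drop; last exact: (leq_trans (ltnW lij)).
  rewrite -ltnS (leq_trans _ ks) // !ltnS -[X in (_ < X)%N](subnKC js).
  by rewrite ltn_add2r.
move=> t [ts tQ tsum]; exists t; split => //.
  apply: (subseq_trans ts); rewrite -[X in subseq _ X](cat_take_drop j s).
  rewrite cat_subseq // -[X in subseq _ X](cat_take_drop i).
  by rewrite take_takel ?prefix_subseq // ltnW.
rewrite tsum -[in RHS](cat_take_drop j s) !big_cat /=; congr (_ + _).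
exact: gij.
Qed.

Definition sumset (A : zmodType) (X Y : set A) := [set x + y | x in X & y in Y].

Definition mulrn_range (A : zmodType) (n : nat) : set A :=
  range (fun h : A => h *+ n).

Section FiniteExponent.
Variables (n : nat) (A : zmodType).
Local Notation nA := (@mulrn_range A n.+2).

Lemma mulrn_range0 k : mulrn_range k (0 : A).
Proof. by exists 0 => //; rewrite mul0rn. Qed.

Lemma mulrn_rangeB k (u v : A) : mulrn_range k u -> mulrn_range k v ->
  mulrn_range k (u - v).
Proof.
by move=> [h _ <-] [h' _ <-]; exists (h - h') => //; rewrite mulrnBl.
Qed.

Lemma mulrn_rangeN k (u : A) : mulrn_range k u -> mulrn_range k (- u).
Proof. by rewrite -[- u]add0r => /(mulrn_rangeB (mulrn_range0 k)). Qed.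

Lemma mulrn_rangeD k (u v : A) : mulrn_range k u -> mulrn_range k v ->
  mulrn_range k (u + v).
Proof.
move=> nu /mulrn_rangeN; rewrite -[v in u + v]opprK.
exact: mulrn_rangeB.
Qed.

Variables (m : nat) (g : 'I_m -> A).
Local Notation Z := 'rV['Z_n.+2]_m.

(** The coefficients are representatives below [n.+2], so this map is additive only modulo [nA]; the
    error comes from the carries. *)
Definition combi (a : Z) : A := \sum_i g i *+ (a 0 i : nat).

Lemma combiD a b : nA (combi a + combi b - combi (a + b)).
Proof.
exists (\sum_i g i *+ ((a 0%R i + b 0%R i) %/ n.+2)%N) => //.
rewrite -sumrMnl /combi -big_split -sumrB; apply: eq_bigr => i _ /=.
rewrite mxE /= -mulrnDr {2}(divn_eq (a 0%R i + b 0%R i) n.+2) -mulrnA.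
by rewrite mulrnDr addrK.
Qed.

Lemma combiB a b : nA (combi (a - b) - (combi a - combi b)).
Proof.
have := combiD (a - b) b; rewrite subrK.
by rewrite opprB [combi b - _]addrC addrA [_ - combi a + _]addrAC.
Qed.

Lemma combi_delta i : combi (delta_mx 0 i) = g i.
Proof.
rewrite /combi (bigD1 i) //= mxE !eqxx big1 ?addr0 // => j ji.
by rewrite mxE (negPf ji) andbF.
Qed.

Lemma combi_sum (s : seq 'I_m) :
  nA (combi (\sum_(i <- s) delta_mx 0 i) - \sum_(i <- s) g i).
Proof.
elim: s => [|i s IHs].
  rewrite !big_nil /combi big1 ?subr0; first exact: mulrn_range0.
  by move=> i _; rewrite mxE.
rewrite !big_cons; have := mulrn_rangeB IHs
  (combiD (delta_mx 0 i) (\sum_(i <- s) delta_mx 0 i)).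
rewrite combi_delta; congr (mulrn_range _ _).
by rewrite opprB addrC !opprD !addrA subrK.
Qed.

End FiniteExponent.

Section Congruence.
Variables (A : zmodType) (n : nat).
Implicit Types u v : A.

Definition congr_mod u v := mulrn_range n (u - v).

Lemma congr_mod_sym u v : congr_mod u v -> congr_mod v u.
Proof. by move=> /mulrn_rangeN; rewrite opprB. Qed.

Lemma congr_mod_trans v u u' :
  congr_mod u v -> congr_mod v u' -> congr_mod u u'.
Proof. by move=> uv /(mulrn_rangeD uv); rewrite addrA subrK. Qed.

Lemma congr_modB u v u' v' :
  congr_mod u v -> congr_mod u' v' -> congr_mod (u - u') (v - v').
Proof.
move=> uv /(mulrn_rangeB uv); congr (mulrn_range _ _).
by rewrite !opprD !opprK addrACA.
Qed.

Lemma congr_modD u v u' v' :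
  congr_mod u v -> congr_mod u' v' -> congr_mod (u + u') (v + v').
Proof.
by move=> uv /(mulrn_rangeD uv); rewrite addrACA -opprD.
Qed.

End Congruence.

(** Pull [V] back along [combi] to a dense set [E] in a power of Z/n. Bogolyubov's theorem reduces
    matters to at most [size F ^ 2] frequencies, and a short subsum can match the full sum at all of
    these. *)
Lemma bogolyubov_mod (A : zmodType) (n : nat) (V : set A) (F : seq A) :
  (forall g, exists2 f, f \in F &
     exists2 v, V v & mulrn_range n.+2 (g - f - v)) ->
  forall s : seq A, exists t : seq A, [/\ {subset t <= s},
    (size t <= n.+2 ^ (size F ^ 2))%N &
    exists v1 v2 v3 v4, [/\ V v1, V v2, V v3, V v4 &
      mulrn_range n.+2
        (\sum_(x <- s) x - \sum_(x <- t) x - (v1 - v2 + (v3 - v4)))]].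
Proof.
move=> VF s; pose m := size s; pose k := size F.
have [w wP] := @C_prim_root_exists n.+2 isT.
pose Z := 'rV['Z_n.+2]_(m + k).
pose g (i : 'I_(m + k)) : A := (s ++ F)`_i.
pose E : {set Z} :=
  [set a | `[< exists2 v, V v & mulrn_range n.+2 (combi g a - v) >]]%SET.
have [|L Lk LE] := @bogolyubov_chi _ _ w wP E k.
  (* Elements of [F] become basis vectors, so [k] translates of [E] cover [Z]; this is the density
     that [bogolyubov_chi] asks for. *)
  pose tr (p : 'I_k * Z) : Z := p.2 + delta_mx 0 (rshift m p.1).
  have trE : [set: Z]%SET \subset tr @: finset.setX [set: 'I_k]%SET E.
    apply/fintype.subsetP => a _.
    have [f fF [v Vv avn]] := VF (combi g a).
    have jk : (index f F < k)%N by rewrite index_mem.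
    apply/imsetP; exists (Ordinal jk, a - delta_mx 0 (rshift m (Ordinal jk))).
      rewrite finset.in_setX finset.in_setT /= finset.in_set; apply/asboolP.
      exists v => //.
      have := mulrn_rangeD (combiB g a (delta_mx 0 (rshift m (Ordinal jk)))) avn.
      rewrite combi_delta (_ : g _ = f) 1?addrA 1?subrK //.
      by rewrite /g /= nth_cat ltnNge leq_addr /= addKn nth_index.
    by rewrite /tr /= subrK.
  rewrite -cardsT; apply: (leq_trans (subset_leq_card trE)).
  by apply: (leq_trans (leq_imset_card _ _)); rewrite cardsX cardsT card_ord.
pose dots (x : Z) : 'rV['Z_n.+2]_#|L| := \row_l dot (enum_val l) x.
have dotsB x y : dots (x - y) = dots x - dots y.
  by apply/rowP => l; rewrite !mxE dotDr dotNr.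
have dotsD x y : dots (x + y) = dots x + dots y.
  by apply/rowP => l; rewrite !mxE dotDr.
have dots0 : dots 0 = 0 by apply/rowP => l; rewrite !mxE dot0r.
pose delta (i : 'I_m) : Z := delta_mx 0 (lshift k i).
have [t [_ tL tsum]] := short_subsum (dots \o delta) (index_enum 'I_m).
exists [seq s`_i | i : 'I_m <- t]; split.
- by move=> _ /mapP[i _ ->]; exact: mem_nth.
- rewrite size_map (leq_trans tL) // card_mx mul1n card_ord.
  by rewrite leq_pexp2l.
(* The full sum and the subsum agree at every frequency of [L], so [y] lies in their common
   kernel. *)
pose y := \sum_(i <- index_enum 'I_m) delta i - \sum_(i <- t) delta i.
have [a aL|x1 [x2 [x3 [x4 [+ + + + yE]]]]] := LE y.
  have : dots y = 0.
    rewrite dotsB !(big_morph dots dotsD dots0) -/dots.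
    by apply/eqP; rewrite subr_eq0; apply/eqP; exact: esym.
  by move/rowP/(_ (enum_rank_in aL a)); rewrite !mxE enum_rankK_in.
rewrite !finset.in_set => /asboolP[v1 V1 c1] /asboolP[v2 V2 c2].
move=> /asboolP[v3 V3 c3] /asboolP[v4 V4 c4].
exists v1, v2, v3, v4; split => //.
have combi_deltas r : congr_mod n.+2 (combi g (\sum_(i <- r) delta i))
    (\sum_(i <- r) s`_i).
  have := @combi_sum n _ _ g [seq lshift k i | i <- r]; rewrite !big_map.
  congr (mulrn_range _ (_ - _)); apply: eq_bigr => i _.
  by rewrite /g nth_cat /= ltn_ord.
have cy : congr_mod n.+2 (combi g y)
    (\sum_(x <- s) x - \sum_(x <- [seq s`_i | i : 'I_m <- t]) x).
  apply: congr_mod_trans (combiB g _ _) _; apply: congr_modB.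
    by rewrite (big_nth 0) big_mkord; exact: combi_deltas.
  by rewrite big_map; exact: combi_deltas.
apply: congr_mod_trans (congr_mod_sym cy) _; rewrite yE.
have := combiD g (x1 - x2) (x3 - x4) => /congr_mod_sym yD.
apply: congr_mod_trans yD _.
by apply: congr_modD;
  apply: congr_mod_trans (combiB g _ _) _; exact: congr_modB.
Qed.

(** * Subgroups *)

Section Subgroups.
Variable A : zmodType.
Implicit Types (M N S B : set A) (x y : A).

Definition is_subgroup M := M 0 /\ forall x y, M x -> M y -> M (x - y).

Lemma subgroupN M x : is_subgroup M -> M x -> M (- x).
Proof. by move=> [M0 MB] Mx; rewrite -sub0r; exact: MB. Qed.

Lemma subgroupD M x y : is_subgroup M -> M x -> M y -> M (x + y).
Proof.
by move=> sM Mx My; rewrite -[y]opprK; apply: sM.2 => //; exact: subgroupN.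
Qed.

Lemma subgroupMn M x n : is_subgroup M -> M x -> M (x *+ n).
Proof.
move=> sM Mx; elim: n => [|n IHn]; first by rewrite mulr0n; exact: sM.1.
by rewrite mulrS; exact: subgroupD.
Qed.

Lemma subgroup_zmod_closed M : is_subgroup M <-> zmod_closed [in M].
Proof.
split=> [[M0 MB]|[M0 MB]]; split.
- by rewrite inE.
- by move=> x y; rewrite !inE; exact: MB.
- by move: M0; rewrite inE.
- by move=> x y Mx My; have := MB x y; rewrite !inE; apply.
Qed.

Lemma subgroup_mulrn_range n : is_subgroup (@mulrn_range A n).
Proof. by split; [exact: mulrn_range0 | exact: mulrn_rangeB]. Qed.

Lemma subgroup_sumset M N :
  is_subgroup M -> is_subgroup N -> is_subgroup (sumset M N).
Proof.
move=> sM sN; split.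
  by exists 0; [exact: sM.1 | exists 0; [exact: sN.1 | rewrite addr0]].
move=> _ _ [x Mx [y Ny <-]] [x' Mx' [y' Ny' <-]].
exists (x - x'); first exact: sM.2.
by exists (y - y'); [exact: sN.2 | rewrite addrACA opprD].
Qed.

Lemma subgroup_multiples x : is_subgroup (range (fun k : int => x *~ k)).
Proof.
split; first by exists 0.
by move=> _ _ [k _ <-] [l _ <-]; exists (k - l) => //; rewrite mulrzBr.
Qed.

Definition gen S := smallest is_subgroup S.

Lemma subgroup_gen S : is_subgroup (gen S).
Proof.
split=> [M [[M0 _] _] //|x y Sx Sy M [sM SM]].
by apply: sM.2; [exact: Sx | exact: Sy].
Qed.

Lemma sub_gen S : S `<=` gen S.
Proof. exact: sub_gen_smallest. Qed.

Lemma gen_sub S M : is_subgroup M -> S `<=` M -> gen S `<=` M.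
Proof. exact: smallest_sub. Qed.

Lemma gen_sum S x : (forall a, S a -> S (- a)) -> gen S x ->
  exists2 s : seq A, (forall a, a \in s -> S a) & x = \sum_(a <- s) a.
Proof.
move=> SN; pose T := [set x : A | exists2 s : seq A,
  (forall a, a \in s -> S a) & x = \sum_(a <- s) a].
apply: (@gen_sub S T) => [|a Sa]; last first.
  exists [:: a]; last by rewrite big_seq1.
  by move=> b; rewrite inE => /eqP ->.
split; first by exists [::] => //; rewrite big_nil.
move=> _ _ [s Ss ->] [t St ->]; exists (s ++ [seq - a | a <- t]).
  move=> a; rewrite mem_cat => /orP[/Ss //|/mapP[b /St Sb ->]].
  exact: SN.
by rewrite big_cat big_map sumrN.
Qed.

(** The sets obtained for the cyclic subgroups of the generators are added up. [P] will be
    compactness when [M] is discrete, and finiteness when [M] is [nG]. *)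
Lemma gen_seq_sub M (P : set (set A)) (s : seq A) :
  is_subgroup M -> P [set 0] ->
  (forall B C, P B -> P C -> P (sumset B C)) ->
  (forall x, x \in s -> exists2 B, P B &
     forall k : int, sumset M B (x *~ k)) ->
  exists2 B, P B & gen [set` s] `<=` sumset M B.
Proof.
move=> sM P0 PD; elim: s => [|x s IHs] Ps.
  exists [set 0] => //; apply: subset_trans (_ : [set 0] `<=` _).
    by apply: gen_sub => [|x]; [split=> // ? ? -> ->; rewrite subrr | ].
  by move=> _ ->; exists 0; [exact: sM.1 | exists 0; rewrite ?addr0].
have [B PB xB] := Ps x (mem_head _ _).
have [|C PC sC] := IHs; first by move=> y ys; apply: Ps; rewrite inE ys orbT.
exists (sumset B C); first exact: PD.
apply: subset_trans
    (_ : sumset (range (fun k : int => x *~ k)) (gen [set` s]) `<=` _).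
  apply: gen_sub => [|y /=].
    by apply: subgroup_sumset;
      [exact: subgroup_multiples | exact: subgroup_gen].
  rewrite inE => /predU1P[->|ys].
    exists x; first by exists 1.
    by exists 0; [exact: (subgroup_gen _).1 | rewrite addr0].
  exists 0; first by exists 0.
  by exists y; [exact: sub_gen | rewrite add0r].
move=> _ [_ [k _ <-] [y /sC [m Mm [c Cc <-]] <-]].
have [m' Mm' [b Bb <-]] := xB k.
exists (m' + m); first exact: subgroupD.
by exists (b + c); [exists b => //; exists c | rewrite addrACA].
Qed.

Lemma exists_maximal_disjoint_subgroup S : exists M, [/\ is_subgroup M,
  forall x, M x -> S x -> x = 0 &
  forall N, is_subgroup N -> M `<=` N -> (forall x, N x -> S x -> x = 0) ->
    N `<=` M].
Proof.
(* Adjoining 0 lets the empty set, the union of the empty chain, satisfy [P]. *)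
pose P M := is_subgroup (M `|` [set 0]) /\ forall x, M x -> S x -> x = 0.
have [M [[sM MS] maxM]] : exists M, P M /\ forall N, M `<` N -> ~ P N.
  apply: Zorn_bigcup => F FP totF; split.
    split; first by right.
    move=> x y [[X FX Xx]|->] [[Y FY Yy]|->].
    - have [XY|YX] := totF X Y FX FY.
        have [] := (FP Y FY).1.2 x y; [by left; exact: XY|by left| |by right].
        by left; exists Y.
      have [] := (FP X FX).1.2 x y; [by left|by left; exact: YX| |by right].
      by left; exists X.
    - by rewrite subr0; left; exists X.
    - have [] := (FP Y FY).1.2 0 y; [by right|by left| |by right].
      by left; exists Y.
    - by rewrite subr0; right.
  by move=> x [X FX]; exact: (FP X FX).2.
exists (M `|` [set 0]); split=> // [x [|]|N sN MN NS x Nx]; [exact: MS|by []|].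
apply: contrapT => Mx; apply: (maxM N); last first.
  split=> //; suff -> : N `|` [set 0] = N by [].
  by apply/setUidPl => _ ->; exact: sN.1.
split; last by move=> /(_ x Nx) xM; apply: Mx; left.
by move=> y My; apply: MN; left.
Qed.

End Subgroups.

Lemma seq_uniform_bound (T : eqType) (s : seq T) (P : T -> nat -> Prop) :
  (forall y i j, (i <= j)%N -> P y i -> P y j) ->
  (forall y, y \in s -> exists i, P y i) ->
  exists i, forall y, y \in s -> P y i.
Proof.
move=> Pmono; elim: s => [|y s IHs] Ps; first by exists 0%N.
have [i Pi] := Ps y (mem_head _ _).
have [|j Pj] := IHs; first by move=> z zs; apply: Ps; rewrite inE zs orbT.
exists (maxn i j) => z; rewrite inE => /predU1P[->|/Pj].
  exact: Pmono (leq_maxl _ _) Pi.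
exact: Pmono (leq_maxr _ _).
Qed.

(** * Topological abelian groups *)

Section TopologicalGroup.
Variable G : topologicalZmodType.
Implicit Types (A B U V W K M : set G) (x y : G).

Lemma translate_continuous x : continuous (fun y : G => y - x).
Proof.
move=> y; apply: (@continuous_comp _ _ _ (fun y : G => (y, x))
  (fun z : G * G => z.1 - z.2)); last exact: sub_continuous.
by apply: cvg_pair; [exact: cvg_id | exact: cvg_cst].
Qed.

Lemma nbhs_translate W x : nbhs (0 : G) W -> nbhs x [set y | W (y - x)].
Proof. by rewrite -(subrr x) => /(@translate_continuous x x). Qed.

Lemma nbhs0_translate W x : nbhs x W -> nbhs (0 : G) [set y | W (y + x)].
Proof.
move=> Wx; have := @translate_continuous (- x) 0 W.
by rewrite opprK add0r => /(_ Wx).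
Qed.

Lemma nbhs0_sub U : nbhs (0 : G) U ->
  exists2 W, nbhs (0 : G) W & forall a b, W a -> W b -> U (a - b).
Proof.
move=> U0; have : nbhs ((0 : G, 0 : G).1 - (0 : G, 0 : G).2) U.
  by rewrite /= subrr.
move=> /sub_continuous [[A B] /= [A0 B0] AB].
exists (A `&` B); first exact: filterI.
by move=> a b [Aa _] [_ Bb]; exact: (AB (a, b)).
Qed.

Lemma nbhs0_sum n U : nbhs (0 : G) U -> exists W,
  [/\ nbhs (0 : G) W, forall a, W a -> W (- a) &
      forall s : seq G, (size s <= n)%N -> (forall a, a \in s -> W a) ->
        U (\sum_(a <- s) a)].
Proof.
elim: n U => [|n IHn] U U0.
  exists setT; split=> // [|s]; first exact: filterT.
  by rewrite leqn0 => /nilP -> _; rewrite big_nil; exact: nbhs_singleton.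
have [V V0 UV] := nbhs0_sub U0; have [W [W0 WN VW]] := IHn V V0.
exists (W `&` (V `&` [set a | V (- a)])); split.
- apply: filterI => //; apply: filterI => //.
  by have /= := @opp_continuous G 0 V; rewrite oppr0; apply.
- by move=> a [Wa [Va VNa]]; split; [exact: WN | rewrite /= opprK].
- case=> [|a s] ss ws; first by rewrite big_nil; exact: nbhs_singleton.
  rewrite big_cons addrC -[X in _ + X]opprK; apply: UV.
    by apply: VW => // b bs; apply: (ws b _).1; rewrite inE bs orbT.
  by apply: (ws a _).2.2; rewrite mem_head.
Qed.

(** The near-covering form of compactness is applied along the filter of finite lists ordered by
    inclusion; points outside [K] are discarded afterwards. *)
Lemma compact_totally_bounded K W : compact K -> nbhs (0 : G) W ->
  exists2 s : seq G, (forall y, y \in s -> K y) &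
    forall x, K x -> exists2 y, y \in s & W (x - y).
Proof.
move=> /compact_near_coveringP cK W0.
pose F : set_system (seq G) := filter_from setT
  (fun s0 : seq G => [set s : seq G | forall a, a \in s0 -> a \in s]).
have FF : Filter F.
  apply: filter_from_filter; first by exists [::].
  move=> s t _ _; exists (s ++ t) => //= u su; split=> a ha; apply: su.
    by rewrite mem_cat ha.
  by rewrite mem_cat ha orbT.
have [|s _ /(_ s (fun _ => id)) Ks] :=
    cK _ F (fun (s : seq G) x => exists y, [/\ y \in s, K y & W (x - y)]) FF.
  move=> x Kx; exists ([set y | W (y - x)], [set s : seq G | x \in s]) => /=.
    split; first exact: nbhs_translate.
    by exists [:: x] => //= s; apply; rewrite mem_head.
  by move=> [y s] /= [Wy xs]; exists x.
exists [seq y <- s | `[< K y >]] => [y|x Kx].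
  by rewrite mem_filter => /andP[/asboolP].
have [y [ys Ky Wy]] := Ks x Kx.
by exists y => //; rewrite mem_filter ys andbT; exact/asboolP.
Qed.

Lemma compact_sumset A B : compact A -> compact B -> compact (sumset A B).
Proof.
move=> cA cB.
have -> : sumset A B = (fun z : G * G => z.1 + z.2) @` (A `*` B).
  apply/seteqP; split=> [_ [a Aa [b Bb <-]]|_ [[a b] [/= Aa Bb] <-]].
    by exists (a, b).
  by exists a => //; exists b.
apply: continuous_compact; last exact: compact_setX.
by apply: continuous_subspaceT; exact: add_continuous.
Qed.

Lemma compact_translate (A : set G) x :
  compact A -> compact [set a + x | a in A].
Proof.
move=> cA; apply: continuous_compact => //; apply: continuous_subspaceT => y.
by have := @translate_continuous (- x) y; rewrite opprK.
Qed.

Lemma compact_opp (A : set G) : compact A -> compact [set - a | a in A].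
Proof.
move=> cA; apply: continuous_compact => //; apply: continuous_subspaceT => y.
exact: opp_continuous.
Qed.

Lemma mulrn_continuous n : continuous (fun x : G => x *+ n).
Proof.
elim: n => [|n IHn] x; first exact: cvg_cst.
rewrite /continuous_at mulrS.
under eq_fun do rewrite mulrS.
apply: (@continuous_comp _ _ _ (fun y : G => (y, y *+ n))
  (fun z : G * G => z.1 + z.2)); last exact: add_continuous.
by apply: cvg_pair; [exact: cvg_id | exact: IHn].
Qed.

Lemma nbhs_compact : locally_compact [set: G] ->
  exists K, [/\ nbhs (0 : G) K, compact K & forall a, K a -> K (- a)].
Proof.
move=> /(_ 0 I) [K K0 [cK _]].
have {}K0 : nbhs (0 : G) K by apply: (filterS _ (K0 : nbhs _ _)) => x /(_ I).
exists (K `|` [set - a | a in K]); split.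
- by apply: filterS K0; exact: subsetUl.
- by apply: compactU => //; exact: compact_opp.
- move=> a [Ka|[b Kb <-]]; first by right; exists a.
  by left; rewrite opprK.
Qed.

End TopologicalGroup.

Section TopologicalSubgroups.
Local Open Scope quotient_scope.
Variable G : topologicalZmodType.
Implicit Types (M U W K : set G) (x y : G).

Lemma open_subgroup M : is_subgroup M -> nbhs (0 : G) M -> open M.
Proof.
move=> sM M0; rewrite openE => x Mx.
apply: filterS (nbhs_translate x M0) => y /= Myx.
by rewrite -(subrK x y); exact: subgroupD.
Qed.

Lemma open_subgroup_closed M : is_subgroup M -> nbhs (0 : G) M -> closed M.
Proof.
move=> sM M0 x /(_ _ (nbhs_translate x M0)) [y [My Myx]].
by rewrite -(subKr y x); exact: sM.2.
Qed.

Lemma id_comp_sub_clopen (C : set G) : open C -> closed C -> C 0 ->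
  [set` @id_comp G] `<=` C.
Proof.
move=> oC cC C0 x; rewrite /= /id_comp inE => -[B [B0 _ cB] Bx].
have : B `&` C = B.
  by apply: cB; [exists 0 | exists C | exists C].
by move=> /setIidPl; apply.
Qed.

Lemma quot_group_pi_eq (H : zmodClosed G) x y :
  \pi_(quot_group H) x = \pi_(quot_group H) y -> x - y \in H.
Proof.
move=> xy; rewrite (@Quotient.idealrBE _ H x y). apply/eqP. exact: xy. Qed.

Local Notation Q := (quot_group (@id_comp G)).

(** Take lifts of the generators. A proper such [M] is saturated for the projection, so the image of
    its complement is a nonempty open set missing the image of [M], which contains the dense
    subgroup. *)
Lemma tfg_closed_subgroup :
  topologically_finitely_generated Q ->
  exists s : seq G, forall M, is_subgroup M -> closed M ->
    [set` @id_comp G] `<=` M -> [set` s] `<=` M -> M = setT.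
Proof.
move=> [s ds].
exists [seq repr q | q <- s] => M sM cM G0M sM'.
apply/seteqP; split=> // x _; apply: contrapT => Mx.
have oM : open (\pi_Q @` (~` M) : set Q).
  by apply: quot_group_pi_open; exact: closed_openC.
have [|q [[g Mg <-] gs]] := ds _ _ oM; first by exists (\pi_Q x); exists x.
suff [g' Mg' /esym /quot_group_pi_eq gg'] : (\pi_Q @` M) (\pi_Q g).
  apply: Mg.
  by rewrite -(subrK g' g); apply: subgroupD => //; exact: G0M.
apply: gs; split.
  apply: (@subgroup_zmod_closed Q (\pi_Q @` M)).1; split.
    exists 0; first exact: sM.1.
    by have := @quot_group_piB _ (@id_comp G) 0 0; rewrite !subrr.
  move=> _ _ [u Mu <-] [v Mv <-]; exists (u - v); first exact: sM.2.
  exact: quot_group_piB.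
move=> r /= rs; exists (repr r); last exact: reprK.
by apply: sM'; apply/mapP; exists r.
Qed.

End TopologicalSubgroups.

(** * Closedness and openness of nG *)

Section CompactlyGenerated.
Variable G : topologicalZmodType.
Implicit Types (M U W K : set G) (x y : G).

Hypothesis lcG : locally_compact [set: G].
Hypothesis tfgG : topologically_finitely_generated (quot_group (@id_comp G)).

(** A compact symmetric neighbourhood [C] containing the lifted generators generates [G]. Finitely
    many translates of [K], by elements of [t], cover [C + C], so a sum of elements of [C] is
    absorbed term by term into [gen t + C]. *)
Lemma finitely_generated_add_compact : exists (s : seq G) K,
  [/\ compact K & sumset (gen [set` s]) K = setT].
Proof.
have [K [K0 cK KN]] := nbhs_compact lcG.
have [s sP] := tfg_closed_subgroup tfgG.
pose C := K `|` ([set` s] `|` [set - a | a in [set` s]]).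
have cC : compact C.
  apply: compactU => //; apply: compactU; last apply: compact_opp.
    by apply: finite_compact; exact: finite_seq.
  by apply: finite_compact; exact: finite_seq.
have CN a : C a -> C (- a).
  case=> [Ka|[sa|[b sb <-]]]; first by left; exact: KN.
    by right; right; exists a.
  by right; left; rewrite opprK.
have KC : K `<=` C by move=> a; left.
have genC : gen C = setT.
  have sg := subgroup_gen C.
  have g0 : nbhs (0 : G) (gen C).
    by apply: filterS K0; apply: subset_trans KC _; exact: sub_gen.
  apply: sP => //; first exact: open_subgroup_closed.
    apply: id_comp_sub_clopen; last exact: sg.1.
      exact: open_subgroup.
    exact: open_subgroup_closed.
  by move=> a sa; apply: sub_gen; right; left.
have [t _ tP] := compact_totally_bounded (compact_sumset cC cC) K0.
exists t, C; split=> //; apply/seteqP; split=> // x _.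
have [u uC ->] : exists2 u : seq G, (forall a, a \in u -> C a) &
    x = \sum_(a <- u) a.
  by apply: gen_sum => //; rewrite genC.
elim: u uC => [_|a u IHu uC].
  rewrite big_nil; exists 0; first exact: (subgroup_gen _).1.
  by exists 0; [apply: KC; exact: nbhs_singleton | rewrite addr0].
have [|d Dd [c Cc dc]] := IHu.
  by move=> b bu; apply: uC; rewrite inE bu orbT.
have [|y yt Kac] := tP (a + c).
  by exists a; [apply: uC; rewrite mem_head | exists c].
exists (d + y).
  by apply: (subgroupD (subgroup_gen _)) => //; exact: sub_gen.
exists (a + c - y); first exact: KC.
by rewrite big_cons -dc [RHS]addrCA -addrA; congr (_ + _); rewrite addrC subrK.
Qed.

End CompactlyGenerated.

(** * Weil's dichotomy relative to a maximal discrete subgroup *)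

Section MaximalDiscreteSubgroup.
Variable G : topologicalZmodType.
Implicit Types (W K : set G) (x y : G).
Variables M U : set G.
Hypothesis sM : is_subgroup M.
Hypothesis MU : forall x, M x -> U x -> x = 0.
Hypothesis maxM : forall N, is_subgroup N -> M `<=` N ->
  (forall x, N x -> U x -> x = 0) -> N `<=` M.
Hypothesis U0 : nbhs (0 : G) U.
Hypothesis cU : compact U.
Hypothesis UN : forall x, U x -> U (- x).

(* Otherwise [M + Z (x *+ q)] would still meet [U] only in [0] for [q] large. *)
Lemma multiples_recur_near x (i : nat) :
  exists2 j, (i <= j)%N & exists2 m, M m & U (x *+ j - m).
Proof.
apply: contrapT => noj; pose q := i.+1.
have far j m : (i <= j)%N -> M m -> ~ U (x *+ j - m).
  by move=> ij Mm Uj; apply: noj; exists j => //; exists m.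
pose N := sumset M (range (fun k : int => (x *+ q) *~ k)).
have sN : is_subgroup N.
  by apply: subgroup_sumset sM _; exact: subgroup_multiples.
have MN : M `<=` N.
  by move=> m Mm; exists m => //; exists 0; [exists 0 | rewrite addr0].
(* Nonzero multiples of [q] exceed [i] in absolute value, so [far] keeps [N] away from [U] outside
   0. But once [x *+ q] is in [M], it contradicts [far] itself. *)
have Mq : M (x *+ q).
  apply: (maxM sN MN); last first.
    by exists 0; [exact: sM.1 | exists (x *+ q); [exists 1 | rewrite add0r]].
  move=> _ [m Mm [_ [[[|k]|k] _ <-] <-]] Uk.
  - by rewrite addr0 in Uk *; exact: MU.
  - case: (far (q * k.+1)%N (- m)); [by rewrite /q; lia | exact: subgroupN |].
    by rewrite opprK addrC mulrnA.
  - case: (far (q * k.+1)%N m) => //; first by rewrite /q; lia.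
    by rewrite -[X in U X]opprK opprB; apply: UN; rewrite mulrnA.
apply: (far q (x *+ q) (leqW (leqnn i)) Mq).
by rewrite subrr; exact: nbhs_singleton.
Qed.

(** Infinitely many multiples lie in [U] modulo [M], and by compactness infinitely many of them are
    close to one point [y]; subtract two of these that are far apart in index. *)
Lemma multiples_recur x W (i : nat) : nbhs (0 : G) W ->
  exists2 j, (i <= j)%N & exists2 m, M m & W (x *+ j - m).
Proof.
move=> W0; have [V V0 VW] := nbhs0_sub W0.
have [s _ sU] := compact_totally_bounded cU V0.
pose near y j := exists2 m, M m & V (x *+ j - m - y).
have [y recur] : exists y, forall i, exists2 j, (i <= j)%N & near y j.
  apply: contrapT => noy.
  have [] := @seq_uniform_bound _ s
    (fun y i => forall j, (i <= j)%N -> ~ near y j).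
  - by move=> y i0 i1 le01 far j le1; apply: far; exact: leq_trans le1.
  - move=> y ys; apply: contrapT => noi; apply: noy; exists y => i0.
    apply: contrapT => noj; apply: noi; exists i0 => j ij nyj; apply: noj.
    by exists j.
  - move=> b bP; have [j bj [m Mm Uj]] := multiples_recur_near x b.
    by have [y ys Vy] := sU _ Uj; apply: (bP y ys j bj); exists m.
have [j _ [m Mm Vj]] := recur 0%N.
have [l jl [m' Mm' Vl]] := recur (j + i)%N.
exists (l - j)%N; first by lia.
exists (m' - m); first exact: sM.2.
have := VW _ _ Vl Vj; congr (W _); rewrite mulrnBr; last by lia.
by rewrite opprB subrKA !opprB addrACA [RHS]addrACA [- m' - _]addrC.
Qed.

(* From [x *~ k], step forward by [x] until first returning to [M + U]: the
   return times from points of [M + U] are bounded by compactness of [U]. *)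
Lemma multiples_sub_add_compact x :
  exists2 K, compact K & forall k : int, sumset M K (x *~ k).
Proof.
have [W [W0 WN WU]] := nbhs0_sum 3 U0.
have [s _ sU] := compact_totally_bounded cU W0.
pose S := [set z | U z /\ exists k : int, exists2 m, M m & z = x *~ k + m].
have [b bP] : exists b, forall y, y \in s -> forall z, S z -> W (z - y) ->
    exists2 j, (0 < j <= b)%N & exists2 m, M m & U (z - x *+ j - m).
  apply: seq_uniform_bound => [y i j ij jP z Sz Wz|y ys].
    have [l /andP[l0 li] lP] := jP z Sz Wz.
    by exists l => //; rewrite l0 (leq_trans li).
  (* One point [z0] of [S] near [y] serves all others: its index [k0] plus a recurrence time
     [j0 > |k0|] is a positive step [j], and [z - x *+ j] is modulo [M] a sum of three elements of
     [W]. *)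
  have [[z0 [[Uz0 [k0 [m0 Mm0 z0E]]] Wz0]]|noz] :=
    pselect (exists z, S z /\ W (z - y)); last first.
    by exists 0%N => z Sz Wz; case: noz; exists z.
  have [j0 k0j0 [m1 Mm1 Wj0]] := multiples_recur x `|k0|%N.+1 W0.
  pose j := `|(k0 + j0%:Z)%R|%N.
  have jE : j%:Z = k0 + j0%:Z by rewrite /j; lia.
  exists j => z Sz Wz; exists j; first by rewrite /j; lia.
  exists (m0 - m1); first exact: sM.2.
  have := WU [:: z - y; - (z0 - y); - (x *+ j0 - m1)] isT.
  rewrite !big_cons big_nil addr0; have -> : z - x *+ j - (m0 - m1) =
      z - y + (- (z0 - y) - (x *+ j0 - m1)).
    rewrite pmulrn jE mulrzDr -pmulrn [RHS]addrA [- (z0 - y)]opprB subrKA z0E.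
    by rewrite -!addrA -!opprD addrACA.
  apply=> a; rewrite !inE => /or3P[] /eqP ->; [by []|exact: WN|exact: WN].
pose K := \big[setU/set0]_(i < b) [set u - x *+ i | u in U].
exists K.
  apply: bigsetU_compact => i _.
  exact: compact_translate.
move=> k; pose Q i := exists2 m, M m & U (x *~ k + x *+ i - m).
have exQ : exists i, `[< Q i >].
  have [j kj [m Mm Uj]] := multiples_recur_near x `|k|%N.
  exists `|(j%:Z - k)%R|%N; apply/asboolP; exists m => //.
  suff -> : x *~ k + x *+ `|(j%:Z - k)%R|%N = x *+ j by [].
  rewrite !pmulrn -mulrzDr; congr (_ *~ _); lia.
case: (ex_minnP exQ) => i /asboolP [m Mm Ui] imin.
have Sz : S (x *~ k + x *+ i - m).
  split=> //; exists (k + i%:Z), (- m); first exact: subgroupN.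
  by rewrite mulrzDr.
have [y ys Wy] := sU _ Ui.
have [j /andP[j0 jb] [m' Mm' Uj]] := bP y ys _ Sz Wy.
(* Were [j <= i], stepping back by [j] would reach [M + U] at time [i - j], against minimality of
   [i]. *)
have lij : (i < j)%N.
  rewrite ltnNge; apply/negP => ji.
  suff /asboolP /imin : Q (i - j)%N by lia.
  exists (m + m'); first exact: subgroupD.
  have := Uj; congr (U _); rewrite mulrnBr //.
  by rewrite opprD !addrA; congr (_ - _); rewrite [LHS]addrAC.
exists m => //; exists (x *~ k + x *+ i - m - x *+ i).
  rewrite /K -(bigcup_mkord b (fun i => [set u - x *+ i | u in U])) /=.
  exists i => /=; first exact: leq_trans lij jb.
  by exists (x *~ k + x *+ i - m).
by rewrite addrC [_ - m - _]addrAC subrK addrK.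
Qed.

End MaximalDiscreteSubgroup.

Section MultiplesClosed.
Variable G : topologicalZmodType.
Implicit Types (M U W K : set G) (x y : G).

Hypothesis hG : hausdorff_space G.
Hypothesis lcG : locally_compact [set: G].

(** Near [y] only the elements of [M] in the compact set [y + V - K] matter. They are finite in
    number, so locally the sumset is compact. *)
Lemma uniformly_discrete_add_compact_closed M U K : nbhs (0 : G) U ->
  (forall x y, M x -> M y -> U (x - y) -> x = y) -> compact K ->
  closed (sumset M K).
Proof.
move=> U0 MU cK y cly; have [V [V0 cV _]] := nbhs_compact lcG.
pose T := sumset [set v + y | v in V] [set - k | k in K].
have cT : compact T.
  by apply: compact_sumset; [exact: compact_translate | exact: compact_opp].
have [W W0 WU] := nbhs0_sub U0.
have [s _ sT] := compact_totally_bounded cT W0.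
pose near z := [set m | M m /\ W (m - z)].
have fin : finite_set (M `&` T).
  (* Two elements of [M] within [W] of the same [z] coincide; the default 0 occurs only for a [z]
     with no such element. *)
  apply: (@sub_finite_set _ _ ((fun z => xget 0 (near z)) @` [set` s])).
    move=> m [Mm Tm]; have [z zs Wz] := sT _ Tm; exists z => //.
    have [Mm' Wm'] : near z (xget 0 (near z)).
      by apply: (@xgetPex _ 0 (near z)); exists m.
    by apply: MU => //; have := WU _ _ Wm' Wz; rewrite opprB addrA subrK.
  by apply: finite_image; exact: finite_seq.
have /(compact_closed hG) clE : compact (sumset (M `&` T) K).
  by apply: compact_sumset => //; exact: finite_compact.
suff [m [Mm _] [k Kk <-]] : sumset (M `&` T) K y by exists m => //; exists k.
apply: clE => B By.
have [_ [[m Mm [k Kk <-]] [Bmk Vmk]]] :=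
  cly _ (filterI By (nbhs_translate y V0)).
exists (m + k); split=> //; exists m; last by exists k.
split=> //; exists (m + k); first by exists (m + k - y); rewrite ?subrK.
by exists (- k); [exists k | rewrite addrK].
Qed.

Hypothesis tfgG : topologically_finitely_generated (quot_group (@id_comp G)).

(* [G = M + B] with [M] discrete and [B] compact, so that [nG = nM + nB]. *)
Lemma closed_mulrn_range n : closed (@mulrn_range G n).
Proof.
have [U [U0 cU UN]] := nbhs_compact lcG.
have [M [sM MU maxM]] := exists_maximal_disjoint_subgroup U.
have [s [K [cK sK]]] := finitely_generated_add_compact lcG tfgG.
have [||x _|B cB sB] := @gen_seq_sub _ M compact s sM.
- exact: compact_set1.
- exact: compact_sumset.
- exact: (multiples_sub_add_compact sM MU maxM U0 cU UN).
have -> : mulrn_range n =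
    sumset [set m *+ n | m in M] [set b *+ n | b in sumset B K].
  apply/seteqP; split=> [_ [x _ <-]|_ [_ [m _ <-] [_ [b _ <-] <-]]]; last first.
    by exists (m + b); rewrite ?mulrnDl.
  have [d Dd [k Kk <-]] : sumset (gen [set` s]) K x by rewrite sK.
  have [m Mm [b Bb <-]] := sB _ Dd.
  exists (m *+ n); first by exists m.
  exists ((b + k) *+ n).
    by exists (b + k) => //; exists b => //; exists k.
  by rewrite -mulrnDl addrA.
apply: (uniformly_discrete_add_compact_closed U0).
  move=> _ _ [x Mx <-] [y My <-] Uxy; apply/eqP; rewrite -subr_eq0; apply/eqP.
  by apply: MU => //; rewrite -mulrnBl; apply: subgroupMn => //; exact: sM.2.
apply: continuous_compact; last exact: compact_sumset.
by apply: continuous_subspaceT; exact: mulrn_continuous.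
Qed.

(** Division with remainder by [n] settles each cyclic subgroup. *)
Lemma gen_seq_sub_finite (n : nat) (s : seq G) : (0 < n)%N ->
  exists2 B, finite_set B & gen [set` s] `<=` sumset (@mulrn_range G n) B.
Proof.
move=> n0; apply: gen_seq_sub.
- exact: subgroup_mulrn_range.
- exact: finite_set1.
- by move=> B C fB fC; exact: finite_image2.
move=> x _; exists ((fun i : nat => x *+ i) @` `I_n).
  by apply: finite_image; exact: finite_II.
move=> k; have nz : n%:Z != 0 by lia.
exists (x *~ (k %/ n)%Z *+ n); first by exists (x *~ (k %/ n)%Z).
exists (x *+ `|(k %% n)%Z|%N).
  exists `|(k %% n)%Z|%N => //=.
  by rewrite -ltz_nat gez0_abs ?modz_ge0 ?ltz_pmod.
by rewrite !pmulrn -mulrzA gez0_abs ?modz_ge0 // -mulrzDr -divz_eq.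
Qed.

End MultiplesClosed.

Section MultiplesOpen.
Variable G : topologicalZmodType.
Implicit Types (M U W K : set G) (x y : G).

Hypothesis hG : hausdorff_space G.
Hypothesis lcG : locally_compact [set: G].
Hypothesis tfgG : topologically_finitely_generated (quot_group (@id_comp G)).

(** With [G = gen s + K], the first summand is finite modulo [nG] and the second is totally
    bounded. *)
Lemma finite_translates_mulrn_range n V : (0 < n)%N -> nbhs (0 : G) V ->
  exists F : seq G, forall g, exists2 f, f \in F &
    exists2 v, V v & mulrn_range n (g - f - v).
Proof.
move=> n0 V0; have [s [K [cK sK]]] := finitely_generated_add_compact lcG tfgG.
have [B /finite_seqP [b ->] sB] := gen_seq_sub_finite s n0.
have [t _ tK] := compact_totally_bounded cK V0.
exists [seq y + z | y <- b, z <- t] => g.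
have [_ /sB [h nh [y yb <-]] [k Kk <-]] : sumset (gen [set` s]) K g.
  by rewrite sK.
have [z zt Vkz] := tK k Kk.
exists (y + z); first by apply/allpairsP; exists (y, z).
exists (k - z) => //; congr (mulrn_range _ _): nh.
by rewrite -[RHS]addrA -opprD addrACA subrr addr0 -[h + y + k]addrA addrK.
Qed.

(* The bound on the number of summands depends on [V] only, so that the
   neighbourhood [W] of the summands can be chosen after it. *)
Lemma id_comp_sub_mulrn_range n : [set` @id_comp G] `<=` @mulrn_range G n.+2.
Proof.
move=> x G0x; apply: (closed_mulrn_range hG lcG tfgG) => B Bx.
have [U1 [U10 _ U1B]] := nbhs0_sum 2 (nbhs0_translate Bx).
have [V [V0 VN VU1]] := nbhs0_sum 4 U10.
have [F VF] := finite_translates_mulrn_range (isT : 0 < n.+2)%N V0.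
have [W [W0 WN WU1]] := nbhs0_sum (n.+2 ^ (size F ^ 2)) U10.
(* The subgroup generated by [W] is clopen, hence contains the identity component. *)
have [s Ws xE] : exists2 s : seq G, (forall a, a \in s -> W a) &
    x = \sum_(a <- s) a.
  apply: gen_sum => //; move: x G0x {Bx U1B}; apply: id_comp_sub_clopen.
  - apply: open_subgroup; first exact: subgroup_gen.
    by apply: filterS W0; exact: sub_gen.
  - apply: open_subgroup_closed; first exact: subgroup_gen.
    by apply: filterS W0; exact: sub_gen.
  - exact: (subgroup_gen _).1.
have [t [ts tF [v1 [v2 [v3 [v4 [V1 V2 V3 V4]]]]]]] := bogolyubov_mod VF s.
rewrite -xE; set v := _ + (_ - _); set p := _ - v => np.
(* [p] is in [nG] and differs from [x] by a short sum from [W] and by [v], each controlled by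
   [U1]. *)
exists p; split=> //.
have := U1B [:: - \sum_(a <- t) a; - v] isT.
rewrite !big_cons big_nil addr0 /= addrC addrA; apply=> a.
rewrite !inE => /orP[] /eqP ->.
  rewrite -sumrN -(big_map -%R xpredT id); apply: WU1.
    by rewrite size_map.
  by move=> _ /mapP[b /ts/Ws Wb ->]; exact: WN.
have := VU1 [:: - v1; v2; - v3; v4] isT.
rewrite !big_cons big_nil addr0 /v !opprD !opprK addrA; apply=> b.
by rewrite !inE => /or4P[] /eqP ->; [exact: VN| |exact: VN|].
Qed.

Lemma finite_add_closed M K : finite_set M -> closed K -> closed (sumset M K).
Proof.
move=> fM cK.
have -> : sumset M K = \bigcup_(m in M) ((fun y => y - m) @^-1` K).
  apply/seteqP; split=> [_ [m Mm [k Kk <-]]|x [m Mm /= Kx]].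
    by exists m => //=; rewrite addrC addKr.
  by exists m => //; exists (x - m) => //; rewrite addrC subrK.
apply: closed_bigcup => // m _; apply: closed_comp => // x _.
exact: translate_continuous.
Qed.

(** [L] is a finite union of cosets of the closed subgroup [N], hence closed, hence all of [G]. So
    the complement of [N] is also a finite union of cosets, and closed. *)
Lemma nbhs0_mulrn_range n : nbhs (0 : G) (@mulrn_range G n.+2).
Proof.
set N := mulrn_range _; have sN : is_subgroup N := subgroup_mulrn_range _ _.
have cN : closed N by exact: closed_mulrn_range.
have [s sP] := tfg_closed_subgroup tfgG.
have [B fB sB] := gen_seq_sub_finite s (isT : 0 < n.+2)%N.
pose L := sumset N (gen [set` s]).
have LE : L = sumset (B `&` L) N.
  apply/seteqP.
  split=> [_ [u Nu [d sd <-]]|_ [b [_ [u Nu [d sd <-]]] [v Nv <-]]].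
    have [u' Nu' [b Bb bE]] := sB _ sd.
    exists b; last first.
      by exists (u + u'); [exact: subgroupD | rewrite addrC -addrA bE].
    split=> //; exists (- u'); first exact: subgroupN.
    by exists d => //; rewrite -bE addKr.
  by exists (u + v); [exact: subgroupD | exists d => //; rewrite addrAC].
have LT : L = setT.
  apply: sP.
  - by apply: subgroup_sumset => //; exact: subgroup_gen.
  - rewrite LE; apply: finite_add_closed => //.
    by apply: sub_finite_set fB; exact: subIsetl.
  - move=> x /id_comp_sub_mulrn_range Nx; exists x; first exact: Nx.
    by exists 0; [exact: (subgroup_gen _).1 | rewrite addr0].
  - move=> x sx; exists 0; first exact: sN.1.
    by exists x; [exact: sub_gen | rewrite add0r].
have NE : ~` N = sumset (B `\` N) N.
  apply/seteqP; split=> [x Nx|_ [b [_ Nb] [u Nu <-]] Nbu]; last first.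
    by apply: Nb; rewrite -(addrK u b); exact: sN.2.
  have [b [Bb _] [u Nu xE]] : sumset (B `&` L) N x by rewrite -LE LT.
  exists b; last by exists u.
  by split=> // Nb; apply: Nx; rewrite -xE; exact: subgroupD.
apply: open_nbhs_nbhs; split; last exact: sN.1.
rewrite -[N]setCK; apply: closed_openC; rewrite NE.
apply: finite_add_closed => //.
by apply: sub_finite_set fB; exact: subDsetl.
Qed.

End MultiplesOpen.

(** * Closed subgroups of countable index *)

Section Baire.
Variable G : topologicalZmodType.
Implicit Types (M U W K : set G) (x y : G).

Hypothesis hG : hausdorff_space G.
Hypothesis lcG : locally_compact [set: G].

Lemma nbhs_closure x U : nbhs x U -> exists2 W, nbhs x W & closure W `<=` U.
Proof.
move=> /nbhs0_translate /nbhs0_sub [W W0 WU].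
exists [set y | W (y - x)]; first exact: nbhs_translate.
move=> z clz.
have [w [/= Ww Wwz]] : [set y | W (y - x)] `&` [set y | W (y - z)] !=set0.
  by apply: clz; exact: nbhs_translate.
by have /= := WU _ _ Ww Wwz; rewrite opprB [_ + (z - w)]addrC addrA !subrK.
Qed.

(* Baire category: were [M] nowhere dense, a decreasing sequence of compact
   sets with nonempty interior could avoid its cosets one after the other. *)
Lemma closed_subgroup_countable_index_open M (g : nat -> G) :
  is_subgroup M -> closed M -> (forall x, exists i, M (x - g i)) ->
  nbhs (0 : G) M.
Proof.
move=> sM cM Mg; apply: contrapT => M0.
pose fat K := compact K /\ exists x : G, nbhs x K.
(* The premise [fat K] stands under the existential so that [choice] yields a total function
   [next]. *)
have shrink i K : exists K', fat K ->
    [/\ fat K', K' `<=` K & forall x, K' x -> ~ M (x - g i)].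
  have [[cK [x Kx]]|] := pselect (fat K); last by move=> nK; exists set0.
  (* Otherwise the interior of [K] lies in one coset of [M], which makes [M] a neighbourhood of
     0. *)
  have [y Ky My] : exists2 y : G, nbhs y K & ~ M (y - g i).
    apply: contrapT => noy; apply: M0.
    have Mx : nbhs x [set y : G | M (y - g i)].
      apply: filterS (_ : nbhs x K°); last exact/nbhs_interior.
      by move=> y Ky; apply: contrapT => My; apply: noy; exists y.
    have /= Mxg := nbhs_singleton Mx.
    apply: filterS (nbhs0_translate Mx) => z /= Mzx.
    by rewrite -(addrK (x - g i) z) addrA; exact: sM.2.
  have My' : nbhs y (K `&` [set z : G | ~ M (z - g i)]).
    apply: filterI => //; apply: open_nbhs_nbhs; split=> //.
    apply: (@open_comp _ _ (fun z : G => z - g i) (~` M)).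
      by move=> z _; exact: translate_continuous.
    exact: closed_openC.
  have [W Wy WK] := nbhs_closure My'.
  exists (K `&` closure W) => _; split; first split.
  - by apply: compact_closedI => //; exact: closed_closure.
  - exists y; apply: filterI => //; apply: filterS Wy; exact: subset_closure.
  - exact: subIsetl.
  - by move=> z [_ /WK []].
have [/= next nextP] := choice (fun p : nat * set G => shrink p.1 p.2).
have [K0 [K00 cK0 _]] := nbhs_compact lcG.
pose K := nat_rect (fun=> set G) K0 (fun i K => next (i, K)).
have fatK i : fat (K i).
  elim: i => [|i fi]; first by split=> //; exists 0.
  by have [] := nextP (i, K i) fi.
have Kmono i j : (i <= j)%N -> K j `<=` K i.
  elim: j => [|j IHj]; first by rewrite leqn0 => /eqP ->.
  rewrite leq_eqVlt => /predU1P[-> //|/IHj Kji].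
  by have [_ + _] := nextP (j, K j) (fatK j); move=> /subset_trans; apply.
(* A cluster point of the decreasing sequence lies in every [K i], hence in no coset of [M]. *)
pose F := filter_from [set: nat] K.
have FF : ProperFilter F.
  apply: filter_from_proper; last first.
    by move=> i _; have [_ [x /nbhs_singleton Kx]] := fatK i; exists x.
  apply: filter_from_filter; first by exists 0%N.
  move=> i j _ _; exists (maxn i j) => // x Kx.
  by split; apply: Kmono Kx; rewrite ?leq_maxl ?leq_maxr.
have [|p [_ clp]] := cK0 F FF; first by exists 0%N.
have Kp i : K i p.
  apply: (compact_closed hG (fatK i).1) => B Bp.
  by apply: clp => //; exists i.
have [i Mp] := Mg p.
by have [_ _ /(_ p (Kp i.+1))] := nextP (i, K i) (fatK i); apply.
Qed.

End Baire.

(** * Exponents of finite quotients, and the theorem *)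

Lemma finite_index_exponent (Gamma : groupType) (N : set Gamma) :
  normal_subgroup N -> finite_index N -> exists n, forall g, N (g ^+ n.+2)%g.
Proof.
move=> [[N1 NV] _] fi.
have oneN : N 1%g by move: N1; rewrite inE.
have divN u v : N u -> N v -> N (u / v)%g.
  by move=> Nu Nv; have := NV u v; rewrite !inE; apply.
have NM u v : N u -> N v -> N (u * v)%g.
  move=> Nu Nv; rewrite -[v]invgK; apply: (divN) => //.
  by rewrite -[(v^-1)%g]mul1g; exact: divN.
have NX u k : N u -> N (u ^+ k)%g.
  by move=> Nu; elim: k => [|k IHk]; rewrite ?expg0 // expgS; exact: NM.
pose coset g := [set (g * n)%g | n in N].
have /finite_seqP [s sE] : finite_set (range coset) by exact: fi.
(* Among [size s + 1] powers of [g] two lie in the same coset of [N]; the quotient of the two is a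
   power of [g] in [N]. *)
have small g : exists2 k, (0 < k <= size s)%N & N (g ^+ k)%g.
  have cs k : coset (g ^+ k)%g \in s.
    suff : [set` s] (coset (g ^+ k)%g) by [].
    by rewrite -sE; exists (g ^+ k)%g.
  pose f (i : 'I_(size s).+1) : 'I_(size s) :=
    Ordinal (etrans (index_mem (coset (g ^+ i)%g) s) (cs i)).
  have /injectivePn [i [j ij fij]] : ~~ injectiveb f.
    by apply/injectiveP => /leq_card; rewrite !card_ord ltnn.
  wlog lij : i j ij fij / (i < j)%N.
    move=> wl; have [lij|lji|/val_inj eij] := ltngtP i j.
    - exact: (wl i j).
    - by apply: (wl j i) => //; rewrite eq_sym.
    - by rewrite eij eqxx in ij.
  have cij : coset (g ^+ i)%g = coset (g ^+ j)%g.
    have /= := congr1 (nth set0 s \o val) fij.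
    by rewrite !nth_index.
  exists (j - i)%N.
    rewrite subn_gt0 lij leq_subLR (leq_trans _ (leq_addl _ _)) //.
    by rewrite -ltnS ltn_ord.
  have [n Nn nE] : coset (g ^+ i)%g (g ^+ j)%g.
    by rewrite cij; exists 1%g => //; rewrite mulg1.
  suff <- : n = (g ^+ (j - i))%g by [].
  by apply: (mulgI (g ^+ i)%g); rewrite nE -expgnDr subnKC // ltnW.
have fact_gt1 : (1 < (size s).+2`!)%N.
  by rewrite factS (leq_trans (_ : 1 < (size s).+2)%N) // leq_pmulr // fact_gt0.
(* The factorial is a multiple of every [k] from [small]; starting from [(size s).+2] makes it at
   least 2. *)
exists (size s).+2`!.-2 => g.
have -> : (size s).+2`!.-2.+2 = (size s).+2`! by case: _`! fact_gt1 => [|[]].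
have [k /andP[k0 ks] Ngk] := small g.
have /dvdnP [q ->] : (k %| (size s).+2`!)%N.
  by apply: dvdn_fact; rewrite k0 (leq_trans ks) // ltnW // ltnW.
by rewrite mulnC expgnA; exact: NX.
Qed.

Theorem theorem2p1 (G : topologicalZmodType) (Gamma : groupType)
  (phi : G -> Gamma) :
  hausdorff_space G ->
  locally_compact [set: G] ->
  topologically_finitely_generated (quot_group (@id_comp G)) ->
  countable [set: Gamma] ->
  residually_finite Gamma ->
  {morph phi : x y / (x + y)%R >-> (x * y)%g} ->
  set_surj [set: G] [set: Gamma] phi ->
  continuous (phi : G -> discrete_topology Gamma) /\
  open_map (phi : G -> discrete_topology Gamma).
Proof.
move=> hG lcG tfgG cGamma rfGamma phiD _.
have phi0 : phi 0 = 1%g.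
  by apply: (mulgI (phi 0)); rewrite -phiD addr0 mulg1.
have phiB x y : phi (x - y) = (phi x / phi y)%g.
  by apply: (mulIg (phi y)); rewrite -phiD subrK mulgVK.
have phiMn x n : phi (x *+ n) = (phi x ^+ n)%g.
  by elim: n => [|n IHn]; rewrite ?mulr0n // mulrS phiD IHn expgS.
have preim_subgroup N : group_closed [in N] -> is_subgroup (phi @^-1` N).
  move=> [N1 NV]; split=> [|x y Nx Ny]; first by move: N1; rewrite inE /= phi0.
  by rewrite /= phiB; have := NV (phi x) (phi y); rewrite !inE; apply.
(* By residual finiteness the kernel is an intersection of subgroups containing some [nG], which are
   open and therefore closed. *)
have closed_ker : closed (phi @^-1` [set 1%g]).
  rewrite -rfGamma preimage_bigcap; apply: closed_bigI => N [nN fN].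
  apply: open_subgroup_closed; first exact: preim_subgroup nN.1.
  have [n Nn] := finite_index_exponent nN fN.
  apply: filterS (nbhs0_mulrn_range hG lcG tfgG n) => _ [x _ <-] /=.
  by rewrite phiMn.
have ker0 : nbhs (0 : G) (phi @^-1` [set 1%g]).
  have /countable_injP [f finj] := cGamma.
  (* [g] enumerates representatives of the cosets of the kernel through the injection [f] of [Gamma]
     into [nat]; indices outside the image get the default 0. *)
  pose g i := xget 0 [set x | f (phi x) = i].
  apply: (closed_subgroup_countable_index_open hG lcG (g := g)) => //.
    apply: preim_subgroup; split=> [|u v]; rewrite !inE // => -> ->.
    by rewrite mulgV.
  move=> x; exists (f (phi x)); rewrite /= phiB.
  have /finj -> : f (phi (g (f (phi x)))) = f (phi x).
    by apply: (@xgetPex _ 0 [set y | f (phi y) = f (phi x)]); exists x.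
  - by rewrite mulgV.
  - by rewrite inE.
  - by rewrite inE.
split; last by move=> A _; exact: discrete_open.
move=> x A /nbhs_singleton Ax.
apply: filterS (nbhs_translate x ker0) => y /= yx.
suff -> : phi y = phi x by [].
by rewrite -(subrK x y) phiD yx mul1g.
Qed.
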